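(* Let $n\ge1$, $M\ge2$, let $\mathbf{s}_1,\dots,\mathbf{s}_M\in\mathbb{R}^n$ be any distinct points with $\frac1M\sum_{k=1}^M|\mathbf{s}_k|^2=1$, with any bit mapping (assignment of binary sequences to the points) and any prior probabilities $\Pr\{\mathbf{s}=\mathbf{s}_i\}$ not depending on the SNR. Then the bit error rate BER of the maximum likelihood detector in the AWGN channel is a convex function of the SNR $\gamma$ in the high SNR regime $$\gamma\ge (n+\sqrt{2n})/d_{\min}^2,$$ where $d_{\min}=\min_i d_{\min,i}$ is the minimum distance to the decision region boundary in the constellation.
   Context: Channel model: $\mathbf{r}=\mathbf{s}+\boldsymbol{\xi}$ in $\mathbb{R}^n$, where $\mathbf{s}\in\{\mathbf{s}_1,\dots,\mathbf{s}_M\}$ is the transmitted constellation point and $\boldsymbol{\xi}\sim\mathcal{N}(\mathbf{0},\sigma_0^2\mathbf{I})$ is independent Gaussian noise with density $p_\xi(\mathbf{x})=(2\pi\sigma_0^2)^{-n/2}e^{-|\mathbf{x}|^2/(2\sigma_0^2)}$; $|\cdot|$ is the Euclidean norm. The SNR is $\gamma=1/\sigma_0^2$. The constellation is fixed and $\gamma$ varies. (Coding under maximum likelihood decoding is included by regarding codewords as points of an extended constellation.) The maximum likelihood detector is the minimum distance detector $\hat{\mathbf{s}}=\arg\min_{\mathbf{s}_k}|\mathbf{r}-\mathbf{s}_k|$ (ties have probability zero). The decision (Voronoi) region of $\mathbf{s}_k$ is $V_k=\{\mathbf{y}\in\mathbb{R}^n: |\mathbf{y}-\mathbf{s}_k|\le|\mathbf{y}-\mathbf{s}_l|\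 \text{for all } l\}$. The pairwise error probability is $\Pr\{\mathbf{s}_i\to\mathbf{s}_j\}=\Pr[\hat{\mathbf{s}}=\mathbf{s}_j\mid\mathbf{s}=\mathbf{s}_i]=\int_{V_j-\mathbf{s}_i}p_\xi(\mathbf{x})\,d\mathbf{x}$ for $i\ne j$. The bit error rate is $$\mathrm{BER}=\sum_{i=1}^M\sum_{j\ne i}\frac{h_{ij}}{\log_2 M}\Pr\{\mathbf{s}=\mathbf{s}_i\}\Pr\{\mathbf{s}_i\to\mathbf{s}_j\},$$ where $h_{ij}$ is the Hamming distance between the binary sequences (of common length) representing $\mathbf{s}_i$ and $\mathbf{s}_j$. $d_{\min,i}$ is the minimum distance from $\mathbf{s}_i$ to the boundary of $V_i$, i.e. $d_{\min,i}=\frac12\min_{l\ne i}|\mathbf{s}_l-\mathbf{s}_i|$. *)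

(* Defs.v *)
From HB Require Import structures.
From mathcomp Require Import all_boot all_order all_algebra.
From mathcomp Require Import all_classical all_reals all_analysis.

Set Implicit Arguments.
Unset Strict Implicit.
Unset Printing Implicit Defensive.

Import Order.TTheory GRing.Theory Num.Theory.
Import numFieldNormedType.Exports.

Local Open Scope classical_set_scope.
Local Open Scope ring_scope.

Definition measure_rV_display : measure_display.
Proof. exact: default_measure_display. Qed.

(* The sigma-algebra on R^n generated by the coordinate projections, i.e. the
   Borel sets; this mirrors the library instance on n.-tuple T. *)
Section measurable_rV.
Context {R : realType} {n : nat}.

Let coord (i : 'I_n) (x : 'rV[R]_n) : R := x ord0 i.

Let rV_set0 : g_sigma_preimage coord set0.
Proof. exact: sigma_algebra0. Qed.

Let rV_setC A : g_sigma_preimage coord A -> g_sigma_preimage coord (~` A).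
Proof. exact: sigma_algebraC. Qed.

Let rV_bigcup (F : (set 'rV[R]_n)^nat) :
  (forall i, g_sigma_preimage coord (F i)) ->
  g_sigma_preimage coord (\bigcup_i (F i)).
Proof. exact: sigma_algebra_bigcup. Qed.

HB.instance Definition _ := @isMeasurable.Build measure_rV_display
  'rV[R]_n (g_sigma_preimage coord) rV_set0 rV_setC rV_bigcup.

Lemma measurable_rV_coord (i : 'I_n) :
  measurable_fun [set: 'rV[R]_n] (fun x : 'rV[R]_n => x ord0 i).
Proof.
move=> _ Y mY; rewrite setTI; apply: sub_sigma_algebra => /=.
rewrite -bigcup_seq/=; exists i => /=; first by rewrite mem_index_enum.
by exists Y => //; rewrite setTI.
Qed.

End measurable_rV.

Lemma measurable_fun_rV d (T : measurableType d) (R : realType) n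
    (f : T -> 'rV[R]_n) :
  (forall i, measurable_fun [set: T] (fun t => f t ord0 i)) ->
  measurable_fun [set: T] f.
Proof.
move=> mf; apply: (@measurability _ _ _ _ _ _ (\big[setU/set0]_(i < n)
  preimage_set_system setT (fun x : 'rV[R]_n => x ord0 i) measurable)) => //.
move=> A [B]; rewrite -bigcup_seq/= => -[i _ [C mC <-{B}]] <-{A}.
rewrite !setTI -comp_preimage -[X in measurable X]setTI.
exact: mf.
Qed.

(* Lebesgue measure on R^n, by recursion on n: transport of the product of the
   one-dimensional Lebesgue measure with the n-dimensional one along
   R * R^n -> R^(1 + n). *)
Section lebesgue_measure_rV.
Context {R : realType}.

Definition cons_rV n (p : measurableTypeR R * 'rV[R]_n) : 'rV[R]_n.+1 :=
  row_mx (const_mx p.1 : 'rV[R]_1) p.2.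

Definition uncons_rV n (x : 'rV[R]_n.+1) : measurableTypeR R * 'rV[R]_n :=
  (x ord0 ord0, rsubmx (x : 'rV[R]_(1 + n))).

Lemma cons_rVK n : cancel (@cons_rV n) (@uncons_rV n).
Proof.
move=> [a v]; congr pair; last exact: row_mxKr.
have e : row_mx (const_mx a : 'rV_1) v ord0 (lshift n ord0) = a.
  by rewrite row_mxEl mxE.
by rewrite -[RHS]e; congr (row_mx _ _ _ _); exact: val_inj.
Qed.

Lemma measurable_cons_rV n : measurable_fun [set: measurableTypeR R * 'rV[R]_n] (@cons_rV n).
Proof.
apply: measurable_fun_rV => i.
have [j ->|j ->] := @split_ordP 1 n i.
- rewrite (_ : (fun _ => _) = fst); first exact: measurable_fst.
  by apply/funext => p; exact: etrans (row_mxEl _ _ _ _) (mxE _ _ _ _).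
- rewrite (_ : (fun _ => _) = (fun x : 'rV[R]_n => x ord0 j) \o snd).
    exact: (measurableT_comp (measurable_rV_coord j) measurable_snd).
  by apply/funext => p; exact: row_mxEr.
Qed.

Lemma measurable_uncons_rV n : measurable_fun [set: 'rV[R]_n.+1] (@uncons_rV n).
Proof.
apply: measurable_fun_pair; first exact: measurable_rV_coord.
apply: measurable_fun_rV => i; under eq_fun do rewrite mxE.
exact: measurable_rV_coord.
Qed.

Section step.
Variables (n : nat) (mu : {sigma_finite_measure set 'rV[R]_n -> \bar R}).

Definition lebesgue_cons : set 'rV[R]_n.+1 -> \bar R :=
  pushforward (lebesgue_measure \x mu)%E (@cons_rV n).

Let lebesgue_cons0 : lebesgue_cons set0 = 0%E.
Proof. by rewrite /lebesgue_cons /pushforward preimage_set0 measure0. Qed.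

Let lebesgue_cons_ge0 A : (0 <= lebesgue_cons A)%E.
Proof. exact: (measure_ge0 (lebesgue_measure \x mu)%E). Qed.

Let lebesgue_cons_sigma_additive : semi_sigma_additive lebesgue_cons.
Proof.
move=> F mF tF mUF; rewrite /lebesgue_cons /pushforward preimage_bigcup.
have mcons A : measurable A -> measurable (@cons_rV n @^-1` A).
  by move=> mA; rewrite -[X in measurable X]setTI; exact: measurable_cons_rV.
apply: (@measure_semi_sigma_additive _ _ _ (lebesgue_measure \x mu)%E
  (fun k => @cons_rV n @^-1` F k)) => [k||].
- exact: mcons.
- apply/trivIsetP => i j _ _ ij; rewrite -preimage_setI.
  by move/trivIsetP : tF => /(_ _ _ _ _ ij) ->//; rewrite preimage_set0.
- by rewrite -preimage_bigcup; exact: mcons.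
Qed.

HB.instance Definition _ := isMeasure.Build _ _ _ lebesgue_cons
  lebesgue_cons0 lebesgue_cons_ge0 lebesgue_cons_sigma_additive.

Let lebesgue_cons_sigma_finite : sigma_finite setT lebesgue_cons.
Proof.
have /sigma_finiteP[F [TF ndF Foo]] := sigma_finiteT (@lebesgue_measure R).
have /sigma_finiteP[G [TG ndG Goo]] := sigma_finiteT mu.
exists (fun k => @uncons_rV n @^-1` (F k `*` G k)).
  rewrite -preimage_bigcup -[LHS](preimage_setT (@uncons_rV n)).
  congr preimage; apply/seteqP; split => // -[a v] _.
  have [k _ Fka] : (\bigcup_k F k) a by rewrite -TF.
  have [l _ Glv] : (\bigcup_k G k) v by rewrite -TG.
  exists (maxn k l) => //; split => /=.
    by move: Fka; exact/subsetPset/ndF/leq_maxl.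
  by move: Glv; exact/subsetPset/ndG/leq_maxr.
move=> k; have [mF Fk] := Foo k; have [mG Gk] := Goo k; split.
  rewrite -[X in measurable X]setTI.
  by apply: measurable_uncons_rV => //; exact: measurableX.
rewrite /lebesgue_cons /pushforward -comp_preimage.
rewrite (_ : _ \o _ = id); last by apply/funext => p /=; rewrite cons_rVK.
by rewrite preimage_id product_measure1E// lte_mul_pinfty// ge0_fin_numE.
Qed.

HB.instance Definition _ :=
  Measure_isSigmaFinite.Build _ _ _ lebesgue_cons lebesgue_cons_sigma_finite.

End step.

Fixpoint lebesgue_rV n : {sigma_finite_measure set 'rV[R]_n -> \bar R} :=
  match n with
  | 0 => \d_(0 : 'rV[R]_0)
  | n'.+1 => lebesgue_cons (lebesgue_rV n')
  end.

End lebesgue_measure_rV.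

(* The library norm on 'rV[R]_n is the sup norm. *)
Definition enorm (R : realType) n (x : 'rV[R]_n) : R :=
  Num.sqrt (\sum_(k < n) x ord0 k ^+ 2).

Definition boundary (T : topologicalType) (A : set T) : set T :=
  closure A `\` A°.

Definition hamming m (a b : m.-tuple bool) : nat :=
  #|[pred k : 'I_m | tnth a k != tnth b k]|.

Definition log2 (R : realType) (x : R) : R := ln x / ln 2.

Section awgn.
Context {R : realType} {n M : nat}.
Variable s : 'I_M -> 'rV[R]_n.

(* Density of N(0, v I), where v = sigma_0^2 is the noise variance. *)
Definition noise_pdf (v : R) (x : 'rV[R]_n) : R :=
  (2 * pi * v) `^ (- (n%:R / 2)) * expR (- (enorm x ^+ 2 / (2 * v))).

(* Decision region of the minimum distance (maximum likelihood) detector; the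
   regions overlap only in a null set of ties. *)
Definition voronoi (k : 'I_M) : set 'rV[R]_n :=
  [set y | forall l, enorm (y - s k) <= enorm (y - s l)].

(* Pr{s_i -> s_j}, for i != j, at noise variance v. *)
Definition pairwise_error (v : R) (i j : 'I_M) : R :=
  \int[lebesgue_rV n]_(x in [set y - s i | y in voronoi j]) noise_pdf v x.

Definition bit_error_rate m (bits : 'I_M -> m.-tuple bool) (prior : 'I_M -> R)
    (v : R) : R :=
  \sum_(i < M) \sum_(j < M | j != i)
    (hamming (bits i) (bits j))%:R / log2 M%:R * prior i * pairwise_error v i j.

(* The topology of 'rV[R]_n is the Euclidean one. The infimum is attained as
   soon as the boundary is nonempty, i.e. when M >= 2 and s is injective; then
   it equals the minimum over l != i of enorm (s l - s i) / 2. *)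
Definition dmin_pt (i : 'I_M) : R :=
  inf [set enorm (y - s i) | y in boundary (voronoi i)].

Definition dmin : R := inf (range dmin_pt).

End awgn.

(* Main.v *)
(* As a function of the SNR gamma, the noise density at a point x is a constant
   times gamma^a exp(- b gamma) with a = n/2 and b = |x|^2/2, whose second
   derivative has the sign of (b gamma - a)^2 - a. It is therefore convex where
   b gamma >= a + sqrt a, i.e. gamma |x|^2 >= n + sqrt (2 n). Every noise vector
   x that causes an error has |x| >= dmin, because the segment from s_i to
   s_i + x meets the boundary of the decision region of s_i; so in the stated
   regime the integrands of all pairwise error probabilities are convex in gamma,
   and BER is a nonnegative combination of their integrals. *)
Require Import Defs.
From HB Require Import structures.
From mathcomp Require Import all_boot all_order all_algebra.
From mathcomp Require Import all_classical all_reals all_analysis.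
From mathcomp Require Import measurable_realfun ring lra.
Import Order.TTheory GRing.Theory Num.Theory.
Import numFieldNormedType.Exports.
Local Open Scope classical_set_scope.
Local Open Scope ring_scope.
Set Implicit Arguments.
Unset Strict Implicit.

(** * Convexity of [z ^ a * exp (- b z)] for large [z] *)

Lemma convex_ln_expR (R : realType) (a b x y : R) (t : {i01 R})
    (f : R^o -> R^o) :
  (forall z, f z = expR (a * ln z - b * z)) ->
  0 <= a -> 0 < x -> 0 < y ->
  a + Num.sqrt a <= b * x -> a + Num.sqrt a <= b * y ->
  f (conv t (x : R^o) (y : R^o)) <= conv t (f x : R^o) (f y : R^o).
Proof.
move=> fE a0; wlog xy : t x y / x <= y => [hwlog x0 y0 ax ay|x0 _ ax _].
  have [|/ltW] := leP x y => [xy|yx]; first by apply: hwlog.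
  by rewrite convC [leRHS]convC; apply: hwlog.
have {fE}-> : f = fun z => expR (a * ln z - b * z) by apply/funext.
pose h (z : R) : R := expR (a * ln z - b * z).
pose h1 (z : R) : R := (a / z - b) * h z.
pose h2 (z : R) : R := ((b * z - a) ^+ 2 - a) / z ^+ 2 * h z.
have hD (z : R) : 0 < z -> is_derive z 1 h (h1 z).
  move=> z0; have lnz := is_derive1_ln z0.
  have D : is_derive z (1 : R) (fun z : R => a * ln z - b * z) (a / z - b).
    by apply: is_derive_eq; rewrite /GRing.scale/=; ring.
  by apply: (is_derive_eq (is_derive1_comp (f := expR) _ D)); rewrite mulrC.
have h1D (z : R) : 0 < z -> is_derive z 1 h1 (h2 z).
  move=> z0; have hz := hD _ z0; have z0' : z != 0 by rewrite gt_eqF.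
  have Vz : is_derive z (1 : R) (fun z => z^-1) (- z ^- 2).
    by apply: (is_derive_eq (is_deriveV _ _)) => //; rewrite /GRing.scale/= mulr1.
  have D : is_derive z (1 : R) (fun z : R => a / z - b) (- a / z ^+ 2).
    by apply: is_derive_eq; rewrite /GRing.scale/= subr0; ring.
  by apply: (is_derive_eq (is_deriveM D hz)); rewrite /GRing.scale/= /h1 /h2; field.
(* The formula [h1] is the derivative only on the positive reals; agreement near [z] is enough to
   differentiate once more. *)
have Dh (z : R) : 0 < z -> \near z, h1 z = 'D_1 h z.
  move=> z0; near=> w; have w0 : 0 < w by near: w; exact: lt_nbhsr.
  by have [_ ->] := hD _ w0.
have Dh1 (z : R) : 0 < z -> is_derive z 1 ('D_1 h) (h2 z).
  by move=> z0; apply: near_eq_is_derive (Dh _ z0) (h1D _ z0).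
have hc (z : R) : 0 < z -> {for z, continuous h}.
  move=> z0; have [hz _] := hD _ z0.
  exact/differentiable_continuous/derivable1_diffP.
have y0 : 0 < y by exact: lt_le_trans xy.
apply: (second_derivative_convex (f := h)) xy.
- move=> z /andP[xz _]; have z0 := lt_trans x0 xz.
  have [_ ->] := Dh1 _ z0.
  rewrite mulr_ge0 ?expR_ge0// mulr_ge0 ?invr_ge0 ?sqr_ge0// subr_ge0.
  (* Since [b >= 0], the bound at the left endpoint [x] carries over to every [z > x]. *)
  have b0 : 0 <= b.
    by rewrite -(pmulr_lge0 _ x0) (le_trans _ ax)// addr_ge0// sqrtr_ge0.
  have az : Num.sqrt a <= b * z - a.
    by rewrite lerBrDl (le_trans ax)// ler_wpM2l// ltW.
  rewrite -[leLHS](sqr_sqrtr a0) ler_sqr ?nnegrE ?sqrtr_ge0//.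
  exact: le_trans (sqrtr_ge0 _) az.
- exact/cvg_at_left_filter/hc.
- exact/cvg_at_right_filter/hc.
- move=> z; rewrite in_itv/= => /andP[xz _].
  by have [] := hD _ (lt_trans x0 xz).
- move=> z; rewrite in_itv/= => /andP[xz _].
  by have [] := Dh1 _ (lt_trans x0 xz).
Unshelve. all: by end_near.
Qed.

(** * Product integrals over R^n and the Gaussian density *)

(** Tonelli, following the recursion that defines [lebesgue_rV]: each step splits off one
    coordinate, and in dimension 0 the Dirac mass integrates the empty product to 1. *)
Lemma ge0_integral_lebesgue_rV_prod (R : realType) (g : R -> R) (n : nat) :
  (forall x, 0 <= g x) -> measurable_fun setT g ->
  (\int[lebesgue_rV n]_x (\prod_(k < n) g (x ord0 k))%:E =
   (\int[lebesgue_measure]_x (g x)%:E) ^+ n)%E.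
Proof.
move=> g0 mg.
have mprod k : measurable_fun [set: 'rV[R]_k]
    (EFin \o (fun x : 'rV[R]_k => \prod_(i < k) g (x ord0 i))).
  apply/measurable_EFinP.
  apply: (@measurable_prod _ _ _ _ _ _ (fun i (x : 'rV[R]_k) => g (x ord0 i))) => i _.
  exact: measurableT_comp mg (measurable_rV_coord i).
have prod0 k (x : 'rV[R]_k) : 0 <= \prod_(i < k) g (x ord0 i).
  by apply: prodr_ge0.
elim: n => [|n IHn].
  rewrite [lebesgue_rV 0]/= integral_dirac//; last exact: mprod.
  by rewrite diracT mul1e big_ord0 expe0.
rewrite [lebesgue_rV n.+1]/=.
rewrite (@ge0_integral_pushforward _ _ _ _ _ _ (@measurable_cons_rV R n))//; last 2 first.
  exact: mprod.
  by move=> x _; rewrite lee_fin.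
rewrite preimage_setT.
transitivity (\int[(lebesgue_measure \x lebesgue_rV n)%E]_z
   ((g z.1)%:E * (\prod_(i < n) g (z.2 ord0 i))%:E))%E.
  apply: eq_integral => -[a v] _ /=; rewrite big_ord_recl EFinM; congr (_%:E * _%:E)%E.
    by have /(congr1 fst)/= -> := cons_rVK (a, v).
  apply: eq_bigr => i _; have /(congr1 snd)/rowP/(_ i)/= <- := cons_rVK (a, v).
  by rewrite [in RHS]mxE; congr (g (cons_rV _ _ _)); exact: val_inj.
rewrite fubini_tonelli1//=.
- rewrite /fubini_F/=.
  transitivity (\int[lebesgue_measure]_x ((g x)%:E *
      (\int[lebesgue_measure]_x (g x)%:E) ^+ n))%E.
    apply: eq_integral => x _; rewrite -IHn ge0_integralZl_EFin//.
    + by move=> y _; rewrite lee_fin; exact: prod0.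
    + exact: mprod.
  rewrite ge0_integralZr//.
  + exact/esym/expeS.
  + exact/measurable_EFinP.
  + by move=> x _; rewrite lee_fin.
  + by apply: expe_ge0; apply: integral_ge0 => x _; rewrite lee_fin.
- apply: emeasurable_funM.
  + by apply/measurable_EFinP; exact: measurableT_comp mg measurable_fst.
  + exact: measurableT_comp (mprod n) measurable_snd.
- by move=> z; apply: mule_ge0; rewrite lee_fin; [exact: g0|exact: prod0].
Qed.

(** Independence of the noise coordinates; it reduces the total mass of the density to the
    one-dimensional normal law. *)
Lemma noise_pdfE (R : realType) n (v : R) (x : 'rV[R]_n) : 0 < v ->
  noise_pdf v x = \prod_(k < n) normal_pdf 0 (Num.sqrt v) (x ord0 k).
Proof.
move=> v0; have s0 : Num.sqrt v != 0 by rewrite gt_eqF// sqrtr_gt0.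
under eq_bigr do rewrite normal_pdfE// /normal_fun subr0.
rewrite big_split/= prodr_const card_ord -expR_sum /noise_pdf; congr (_ * expR _).
  rewrite powRN /normal_peak sqr_sqrtr ?ltW// exprVn; congr (_^-1).
  have pv : 0 <= v * pi *+ 2
    by rewrite mulrn_wge0 ?mulr_ge0 ?pi_ge0 ?ltW.
  rewrite -(powR12_sqrt pv) -powR_mulrn ?powR_ge0// -powRrM.
  by congr (powR _ _); rewrite mulrC// -[RHS]mulr_natl; ring.
rewrite sqr_sqrtr ?sumr_ge0 => [|//|i _]; last exact: sqr_ge0.
rewrite mulr_suml -sumrN; apply: eq_bigr => i _.
by rewrite sqr_sqrtr ?ltW// mulNr -[v *+ 2]mulr_natl.
Qed.

Lemma measurable_enorm (R : realType) n :
  measurable_fun [set: 'rV[R]_n] (@enorm R n).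
Proof.
apply: (@measurableT_comp _ _ _ _ _ _ (@Num.sqrt R)).
  apply: continuous_measurable_fun; exact: sqrt_continuous.
apply: (@measurable_sum _ _ _ _ _ _ (fun k (x : 'rV[R]_n) => x ord0 k ^+ 2)) => i.
exact: measurable_funX (measurable_rV_coord i).
Qed.

Lemma measurable_noise_pdf (R : realType) n (v : R) :
  measurable_fun [set: 'rV[R]_n] (@noise_pdf R n v).
Proof.
apply: measurable_funM => //; apply: measurableT_comp => //.
apply: measurableT_comp => //; apply: measurable_funM => //.
apply: measurable_funX; exact: measurable_enorm.
Qed.

Lemma integrable_noise_pdf (R : realType) n (v : R) : 0 < v ->
  (lebesgue_rV n).-integrable [set: 'rV[R]_n] (EFin \o noise_pdf v).
Proof.
move=> v0; apply/integrableP; split.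
  apply/measurable_EFinP; exact: measurable_noise_pdf.
under eq_integral => x _.
  rewrite /= ger0_norm ?mulr_ge0 ?powR_ge0 ?expR_ge0// noise_pdfE//; over.
rewrite ge0_integral_lebesgue_rV_prod.
- by rewrite integral_normal_pdf -EFin_expe expr1n ltry.
- by move=> x; exact: normal_pdf_ge0.
- exact: measurable_normal_pdf.
Qed.

(** * Euclidean inner product and norm *)

Local Notation "''[' u , v ]" := (\sum_k u ord0 k * v ord0 k).

Lemma enorm_ge0 (R : realType) n (x : 'rV[R]_n) : 0 <= enorm x.
Proof. exact: sqrtr_ge0. Qed.

Lemma sqr_enorm (R : realType) n (x : 'rV[R]_n) : enorm x ^+ 2 = '[x, x].
Proof.
rewrite sqr_sqrtr; last by apply: sumr_ge0 => k _; exact: sqr_ge0.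
by apply: eq_bigr => k _; rewrite expr2.
Qed.

Lemma enormZ (R : realType) n (c : R) (x : 'rV[R]_n) :
  enorm (c *: x) = `|c| * enorm x.
Proof.
rewrite -[`|c|]sqrtr_sqr -sqrtrM ?sqr_ge0// mulr_sumr /enorm.
by congr Num.sqrt; apply: eq_bigr => k _; rewrite mxE exprMn.
Qed.

Lemma enorm_gt0 (R : realType) n (x : 'rV[R]_n) : x != 0 -> 0 < enorm x.
Proof.
move=> x0; rewrite sqrtr_gt0 lt_def sumr_ge0 ?andbT => [|k _]; last exact: sqr_ge0.
apply: contra x0 => /eqP /psumr_eq0P x0; apply/eqP/rowP => k; rewrite mxE.
by apply/eqP; rewrite -sqrf_eq0 x0// => i _; exact: sqr_ge0.
Qed.

Lemma continuous_enorm (R : realType) n : continuous (@enorm R n).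
Proof.
move=> x; apply: (@continuous_comp _ _ _
  (fun x : 'rV[R]_n => \sum_k x ord0 k ^+ 2)).
  apply: cvg_big => [||i _].
  - exact: add_continuous.
  - exact: nbhs_filter.
  - exact: (cvg_comp _ (fun r : R => r ^+ 2)
      (@coord_continuous _ _ _ _ _ _) (@exprn_continuous _ _ _)).
exact: sqrt_continuous.
Qed.

(** * Geometry of the decision regions and of [dmin] *)

Section decision_regions.
Context {R : realType} {n M : nat} (s : 'I_M -> 'rV[R]_n).

(** The terms quadratic in [u] cancel, so comparing the distances to two sites is a linear condition
    on the displacement [u]. *)
Lemma sub_sqr_dist (i l : 'I_M) (u : 'rV[R]_n) :
  enorm (s i + u - s l) ^+ 2 - enorm (s i + u - s i) ^+ 2 =
  enorm (s l - s i) ^+ 2 - 2 * '[u, s l - s i].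
Proof.
rewrite !sqr_enorm mulr_sumr -!sumrB.
by apply: eq_bigr => k _; rewrite !mxE; ring.
Qed.

Lemma dist_le_site (i l : 'I_M) (u : 'rV[R]_n) :
  (enorm (s i + u - s l) <= enorm (s i + u - s i)) =
  (enorm (s l - s i) ^+ 2 <= 2 * '[u, s l - s i]).
Proof.
rewrite -[LHS]ler_sqr ?nnegrE ?enorm_ge0//.
by rewrite -subr_le0 sub_sqr_dist subr_le0.
Qed.

Lemma dist_ge_site (i l : 'I_M) (u : 'rV[R]_n) :
  (enorm (s i + u - s i) <= enorm (s i + u - s l)) =
  (2 * '[u, s l - s i] <= enorm (s l - s i) ^+ 2).
Proof.
rewrite -[LHS]ler_sqr ?nnegrE ?enorm_ge0//.
by rewrite -subr_ge0 sub_sqr_dist subr_ge0.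
Qed.

Lemma voronoiP (i : 'I_M) (u : 'rV[R]_n) :
  voronoi s i (s i + u) <->
  forall l, 2 * '[u, s l - s i] <= enorm (s l - s i) ^+ 2.
Proof. by split => h l; have := h l; rewrite dist_ge_site. Qed.

Lemma enorm_ge_dmin_pt (i : 'I_M) (x : 'rV[R]_n) :
  boundary (voronoi s i) x -> dmin_pt s i <= enorm (x - s i).
Proof.
move=> xi; apply: ge_inf; last by exists x.
by exists 0 => _ [y _ <-]; exact: enorm_ge0.
Qed.

(** The point [p] is where the ray from [s i] along [u] first crosses a bisector; the bisector with
    [s j] is crossed at parameter at most 1, so [p] lies no further than [s i + u]. *)
Lemma voronoi_ray_boundary (i j : 'I_M) (u : 'rV[R]_n) :
  s i != s j -> enorm (s i + u - s j) <= enorm (s i + u - s i) ->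
  exists2 p, boundary (voronoi s i) p & enorm (p - s i) <= enorm u.
Proof.
move=> sij; rewrite dist_le_site => uj.
have d_gt0 l : 0 < '[u, s l - s i] -> 0 < enorm (s l - s i).
  move=> ul; apply: enorm_gt0; apply: contraTneq ul => ->.
  by rewrite big1 ?ltxx// => k _; rewrite mxE mulr0.
have uj0 : 0 < '[u, s j - s i].
  rewrite -(@pmulr_rgt0 _ 2)// (lt_le_trans _ uj)// exprn_gt0// enorm_gt0//.
  by rewrite subr_eq0 eq_sym.
(* [r l] is the parameter at which the ray from [s i] along [u] crosses the
   bisector of [s i] and [s l]. *)
pose r l := enorm (s l - s i) ^+ 2 / (2 * '[u, s l - s i]).
pose P l := 0 < '[u, s l - s i].
have [l Pl rl] := @arg_minP _ _ _ j P r uj0.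
have r0 k : P k -> 0 <= r k.
  by move=> Pk; rewrite divr_ge0 ?sqr_ge0// mulr_ge0// ltW.
have dotE (c : R) (w z : 'rV[R]_n) : '[c *: u + w, z] = c * '[u, z] + '[w, z].
  rewrite mulr_sumr -big_split/=; apply: eq_bigr => k _; rewrite !mxE; ring.
exists (s i + r l *: u); last first.
  rewrite addrAC subrr add0r enormZ ger0_norm ?r0// ler_piMl ?enorm_ge0//.
  by rewrite (le_trans (rl _ uj0))// ler_pdivrMr ?mul1r// mulr_gt0.
split.
  (* Sites [k] ahead of the ray have [r l <= r k]; for the others the inner product is nonpositive
     and the inequality is immediate. *)
  apply: subset_closure; apply/voronoiP => k.
  rewrite -[_ *: u]addr0 dotE [X in _ + X]big1 ?addr0; last first.
    by move=> h _; rewrite mxE mul0r.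
  have [Pk|Pk] := ltP 0 '[u, s k - s i].
    by rewrite mulrCA -ler_pdivlMr ?rl// mulr_gt0.
  rewrite (le_trans _ (sqr_ge0 _))// mulr_ge0_le0// mulr_ge0_le0//.
  exact: r0.
move=> /=; rewrite /interior => pV.
(* If [p] were interior, a small push towards [s l] would stay in the region; but [p] is on the
   bisector with [s l], so any such push crosses it. *)
have [e [e0]] : exists e : R, 0 < e /\
    voronoi s i (s i + r l *: u + e *: (s l - s i)).
  set p := s i + _ in pV *; set d := s l - s i.
  have cvp : p + e *: d @[e --> (0 : R)^'+] --> p.
    rewrite -[X in _ --> X]addr0 -(scale0r d); apply: cvgD; first exact: cvg_cst.
    by apply: cvgZr_tmp; exact/cvg_at_right_filter/cvg_id.
  apply: (@filter_ex _ (0 : R)^'+).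
  near=> e; split; first by near: e; exact: nbhs_right_gt.
  by near: e; exact: cvp pV.
rewrite -addrA => /voronoiP/(_ l); rewrite dotE mulrDr.
have -> : 2 * (r l * '[u, s l - s i]) = enorm (s l - s i) ^+ 2.
  by rewrite /r; field; rewrite gt_eqF.
rewrite gerDl leNgt => /negP; apply; rewrite mulr_gt0//.
rewrite (_ : \sum_k _ = e * enorm (s l - s i) ^+ 2).
  by rewrite mulr_gt0// exprn_gt0// d_gt0.
by rewrite sqr_enorm mulr_sumr; apply: eq_bigr => k _; rewrite !mxE; ring.
Unshelve. all: by end_near.
Qed.

Lemma voronoi_ball (i : 'I_M) (delta : R) (x : 'rV[R]_n) :
  (forall l, l != i -> 2 * delta <= enorm (s l - s i)) ->
  enorm (x - s i) < delta -> voronoi s i x.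
Proof.
move=> sep; rewrite -[x in voronoi _ _ x](subrKC (s i)); set u := x - s i => ud.
apply/voronoiP => l; have [->|li] := eqVneq l i.
  rewrite big1 ?mulr0 ?sqr_ge0// => k _.
  by rewrite !mxE subrr mulr0.
set d := s l - s i.
have ud2 : (2 * enorm u) ^+ 2 <= enorm d ^+ 2.
  rewrite ler_sqr ?nnegrE ?mulr_ge0 ?enorm_ge0//.
  by rewrite (le_trans _ (sep _ li))// ler_pM2l// ltW.
(* Replaces the Cauchy-Schwarz inequality. *)
have : 0 <= enorm (2 *: u - d) ^+ 2 by exact: sqr_ge0.
have -> : enorm (2 *: u - d) ^+ 2 =
    (2 * enorm u) ^+ 2 + enorm d ^+ 2 - 4 * '[u, d].
  rewrite exprMn !sqr_enorm !mulr_sumr -big_split -sumrB/=.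
  by apply: eq_bigr => k _; rewrite !mxE; ring.
lra.
Qed.

(** By continuity a point at distance less than [delta] has a neighbourhood inside the ball of
    [voronoi_ball], hence is interior. *)
Lemma boundary_voronoi_ge (i : 'I_M) (delta : R) (x : 'rV[R]_n) :
  (forall l, l != i -> 2 * delta <= enorm (s l - s i)) ->
  boundary (voronoi s i) x -> delta <= enorm (x - s i).
Proof.
move=> sep [_ xV]; rewrite leNgt; apply/negP => xd; apply: xV.
have cx : enorm (y - s i) @[y --> x] --> enorm (x - s i).
  have cB : {for x, continuous (fun y : 'rV[R]_n => y - s i)}.
    apply: (@continuousB _ _ _ id (cst (s i)));
      [exact: cvg_id|exact: cst_continuous].
  exact: continuous_comp cB (@continuous_enorm _ _ _).
rewrite /interior/=; near=> y. apply: (voronoi_ball sep).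
by near: y; exact: (cvgr_lt _ cx).
Unshelve. all: by end_near.
Qed.

Lemma injective_separated : injective s ->
  exists2 delta : R, 0 < delta &
    forall i l, l != i -> 2 * delta <= enorm (s l - s i).
Proof.
move=> injs; pose F (p : 'I_M * 'I_M) := enorm (s p.2 - s p.1) / 2.
(* The default 1 keeps the minimum positive when there is no pair of distinct indices. *)
exists (\big[Num.min/1]_(p | p.2 != p.1) F p).
  apply: lt_bigmin => // -[i l] /= li.
  by rewrite divr_gt0// enorm_gt0// subr_eq0; apply: contra li => /eqP/injs/= ->.
move=> i l li; rewrite mulrC -ler_pdivlMr//.
exact: (@bigmin_le_cond _ _ _ _ (i, l) _ F).
Qed.

Lemma dmin_gt0 : (2 <= M)%N -> injective s -> 0 < dmin s.
Proof.
move=> M2 injs; have [delta delta0 sep] := injective_separated injs.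
apply: (lt_le_trans delta0); apply: lb_le_inf.
  by exists (dmin_pt s (Ordinal (ltnW M2))); exists (Ordinal (ltnW M2)).
move=> _ [i _ <-]; apply: lb_le_inf; last first.
  by move=> _ [x xi <-]; apply: boundary_voronoi_ge xi => l; exact: sep.
(* The boundary must be shown nonempty, since the infimum of the empty set is 0: the segment from
   [s i] to another site [s j] meets it. *)
have [j ji] : exists j : 'I_M, j != i.
  have [i0|i0] := eqVneq i (Ordinal (ltnW M2)).
    by exists (Ordinal M2); rewrite i0.
  by exists (Ordinal (ltnW M2)); rewrite eq_sym.
have [||p pi _] := @voronoi_ray_boundary i j (s j - s i).
- by apply: contra ji => /eqP/injs/= ->.
- rewrite subrKC subrr /enorm big1 ?sqrtr0 ?enorm_ge0// => k _.
  by rewrite mxE expr0n.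
by exists (enorm (p - s i)); exists p.
Qed.

Lemma dmin_le_error (i j : 'I_M) (x : 'rV[R]_n) : s i != s j ->
  voronoi s j (s i + x) -> dmin s <= enorm x.
Proof.
move=> sij /(_ i) xj; have [p pi px] := voronoi_ray_boundary sij xj.
apply: le_trans px; apply: le_trans (enorm_ge_dmin_pt pi); apply: ge_inf; last by exists i.
(* 0 bounds every [dmin_pt] from below, an empty boundary giving the default value 0. *)
exists 0 => _ [k _ <-]; rewrite /dmin_pt; set A := [set _ | _ in _].
have [->|/set0P A0] := eqVneq A set0; first by rewrite inf0.
by apply: lb_le_inf => // _ [y _ <-]; exact: enorm_ge0.
Qed.
End decision_regions.

(** * Convexity in the SNR, from the density to the error rate *)

Lemma noise_pdf_snrE (R : realType) n (gamma : R) (x : 'rV[R]_n) : 0 < gamma ->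
  noise_pdf gamma^-1 x = (2 * pi) `^ (- (n%:R / 2)) *
    expR (n%:R / 2 * ln gamma - enorm x ^+ 2 / 2 * gamma).
Proof.
move=> g0; rewrite /noise_pdf powRM ?mulr_ge0 ?pi_ge0 ?invr_ge0 ?ltW//.
rewrite -mulrA; congr (_ * _).
rewrite [_^-1 `^ _]/powR invr_eq0 gt_eqF// lnV ?posrE// mulrNN -expRD.
by congr expR; congr (_ - _); rewrite invfM invrK mulrA.
Qed.

Lemma convex_noise_pdf (R : realType) n (x : 'rV[R]_n) (g1 g2 : R)
    (t : {i01 R}) : 0 < g1 -> 0 < g2 ->
  n%:R + Num.sqrt (2 * n%:R) <= enorm x ^+ 2 * g1 ->
  n%:R + Num.sqrt (2 * n%:R) <= enorm x ^+ 2 * g2 ->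
  noise_pdf (conv t (g1 : R^o) (g2 : R^o) : R)^-1 x <=
  conv t (noise_pdf g1^-1 x : R^o) (noise_pdf g2^-1 x : R^o).
Proof.
move=> g1_gt0 g2_gt0 h1 h2; have g0 := convR_gt0 t g1_gt0 g2_gt0.
(* With [a = n / 2], this makes the threshold [n + sqrt (2 n)] equal to [2 (a + sqrt a)]. *)
have sqrtE : Num.sqrt (2 * n%:R) = 2 * Num.sqrt (n%:R / 2) :> R.
  have -> : 2 * n%:R = 2 ^+ 2 * (n%:R / 2) :> R by field.
  by rewrite sqrtrM ?sqr_ge0// sqrtr_sqr ger0_norm.
rewrite !noise_pdf_snrE// !convRE.
rewrite mulrCA [X in _ <= _ + X]mulrCA -mulrDr ler_wpM2l ?powR_ge0//.
apply: (@convex_ln_expR _ (n%:R / 2) (enorm x ^+ 2 / 2) g1 g2 t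
  (fun z => expR (n%:R / 2 * ln z - enorm x ^+ 2 / 2 * z))) => //.
- by rewrite sqrtE in h1; lra.
- by rewrite sqrtE in h2; lra.
Qed.

Section error_probability.
Context {R : realType} {n M : nat} (s : 'I_M -> 'rV[R]_n).

(** As a preimage under translation, the region is visibly cut out by finitely many measurable
    inequalities. *)
Lemma error_regionE (i j : 'I_M) :
  [set y - s i | y in voronoi s j] = [set x | voronoi s j (s i + x)].
Proof.
apply/seteqP; split => [_ [y yj <-]|x xj] /=; first by rewrite subrKC.
by exists (s i + x) => //; rewrite addrAC subrr add0r.
Qed.

Lemma measurable_error_region (i j : 'I_M) :
  measurable [set y - s i | y in voronoi s j].
Proof.
rewrite error_regionE.
have mdist l : measurable_fun [set: 'rV[R]_n] (fun x => enorm (s i + x - s l)).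
  apply: (@measurableT_comp _ _ _ _ _ _ (@enorm R n)).
    exact: measurable_enorm.
  apply: measurable_fun_rV => k.
  under eq_fun do rewrite !mxE.
  apply: measurable_funB => //; apply: measurable_funD => //.
  exact: measurable_rV_coord.
rewrite (_ : [set _ | _] = \bigcap_(l in [set: 'I_M])
    [set x | enorm (s i + x - s j) <= enorm (s i + x - s l)]); last first.
  by apply/seteqP; split => [x xj l _|x xj l]; [exact: xj|exact: xj].
apply: fin_bigcap_measurable => // l _.
have := @measurable_fun_ler _ _ _ _ _ _ (mdist j) (mdist l) measurableT [set true].
by rewrite setTI; apply.
Qed.

Lemma convex_pairwise_error (i j : 'I_M) (g1 g2 : R) (t : {i01 R}) :
  0 < dmin s -> s i != s j -> 0 < g1 -> 0 < g2 ->
  (n%:R + Num.sqrt (2 * n%:R)) / dmin s ^+ 2 <= g1 ->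
  (n%:R + Num.sqrt (2 * n%:R)) / dmin s ^+ 2 <= g2 ->
  pairwise_error s (conv t (g1 : R^o) (g2 : R^o) : R)^-1 i j <=
  conv t (pairwise_error s g1^-1 i j : R^o) (pairwise_error s g2^-1 i j : R^o).
Proof.
move=> d0 sij g1_gt0 g2_gt0 h1 h2; have g0 := convR_gt0 t g1_gt0 g2_gt0.
have mD := measurable_error_region i j.
have int g : 0 < g -> (lebesgue_rV n).-integrable
    [set y - s i | y in voronoi s j] (EFin \o @noise_pdf R n g^-1).
  move=> gg0; apply: integrableS (integrable_noise_pdf _ _) => //.
  by rewrite invr_gt0.
have intZ c g : 0 < g -> (lebesgue_rV n).-integrable
    [set y - s i | y in voronoi s j] (EFin \o (fun x => c * @noise_pdf R n g^-1 x)).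
  move=> gg0; rewrite (_ : _ \o _ =
    fun x => (c%:E * (EFin \o noise_pdf g^-1) x)%E) //.
  by apply: integrableZl => //; exact: int.
have errZ c g : 0 < g -> c * pairwise_error s g^-1 i j =
    \int[lebesgue_rV n]_(x in [set y - s i | y in voronoi s j])
      (c * noise_pdf g^-1 x).
  by move=> gg0; apply/esym/RintegralZl => //; exact: int.
(* The right-hand side becomes a single integral, so that the densities can be compared pointwise on
   the error region. *)
rewrite [leRHS]convRE !errZ// -RintegralD//; [|exact: intZ..].
apply: le_Rintegral => //; [exact: int| |].
  exact: (integrableD mD (intZ _ _ g1_gt0) (intZ _ _ g2_gt0)).
move=> x; rewrite error_regionE => /(dmin_le_error sij) dx.
have xg g : (n%:R + Num.sqrt (2 * n%:R)) / dmin s ^+ 2 <= g -> 0 < g ->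
    n%:R + Num.sqrt (2 * n%:R) <= enorm x ^+ 2 * g.
  rewrite ler_pdivrMr ?exprn_gt0// => /le_trans + gg0; apply.
  rewrite mulrC (ler_wpM2r (ltW gg0))// ler_sqr ?nnegrE ?enorm_ge0//.
  exact: ltW.
by apply: convex_noise_pdf => //; exact: xg.
Qed.

End error_probability.

Unset Implicit Arguments.

Theorem theorem4 (R : realType) (n M m : nat) (s : 'I_M -> 'rV[R]_n)
    (bits : 'I_M -> m.-tuple bool) (prior : 'I_M -> R)
    (hn : (1 <= n)%N) (hM : (2 <= M)%N)
    (hs : injective s)
    (hpower : M%:R^-1 * \sum_(k < M) enorm (s k) ^+ 2 = 1)
    (hprior0 : forall i, 0 <= prior i)
    (hprior1 : \sum_(i < M) prior i = 1) :
  convex_function (R := R) (E := R^o)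
    [set gamma : R | (n%:R + Num.sqrt (2 * n%:R)) / dmin s ^+ 2 <= gamma]
    (fun gamma : R => bit_error_rate s bits prior gamma^-1).
Proof.
move=> t g1 g2; rewrite !inE /= => h1 h2.
have d0 := dmin_gt0 hM hs.
(* Every SNR in the regime is thus positive, and its inverse is a genuine noise variance. *)
have thr0 : 0 < (n%:R + Num.sqrt (2 * n%:R)) / dmin s ^+ 2.
  by rewrite divr_gt0 ?exprn_gt0// ltr_pwDl ?ltr0n// sqrtr_ge0.
have g1_gt0 := lt_le_trans thr0 h1; have g2_gt0 := lt_le_trans thr0 h2.
rewrite [leRHS]convRE /bit_error_rate !mulr_sumr -big_split/=; apply: ler_sum => i _.
rewrite !mulr_sumr -big_split/=; apply: ler_sum => j ji.
(* The weight of each pairwise error is factored out; it is nonnegative because [M >= 1] makes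
   [log2 M] nonnegative. *)
rewrite mulrCA [X in _ <= _ + X]mulrCA -mulrDr ler_wpM2l//.
  rewrite mulr_ge0// divr_ge0// divr_ge0// ln_ge0// ler1n//.
  exact: ltnW.
apply: convex_pairwise_error => //.
by apply: contra ji => /eqP/hs ->.
Qed.
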